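(* Let $\mu=1$, $\delta=\tfrac35$, $\eta=\tfrac15$, $\rho=\tfrac1{20}$, and let $\alpha,\gamma>0$ with $\alpha+\gamma=2$. Consider the frozen system $$\dot v=(CK+AD-M)v,\qquad \dot A=\eta C-A\,\mathbf 1^\top Dv-\rho A,\qquad C=1-\mathbf 1^\top v-A,\qquad v=(L,R)^\top,$$ with parameters $\pi=(\alpha_L,\alpha_R,\gamma_{LR},\gamma_{RL},\mu_L,\mu_R,\delta_L,\delta_R)\in(0,\infty)^8$, with $\eta=\tfrac15$, $\rho=\tfrac1{20}$ fixed, and let $\pi_0=(\alpha,\alpha,\gamma,\gamma,\mu,\mu,\delta,\delta)$ be the symmetric baseline. At $\pi=\pi_0$, in coordinates $(L,R,A)$, the radical-free equilibrium $E^\dagger=(0,0,\tfrac45)$, the positive stable equilibrium $E_+=(\tfrac1{12},\tfrac1{12},\tfrac{10}{21})$ and the separating saddle $E_-=(\tfrac3{40},\tfrac3{40},\tfrac12)$ are all hyperbolic equilibria. Moreover these equilibria persist with the same stability types under sufficiently small perturbations of the symmetry assumptions: there exist an open neighbourhood $U\subset(0,\infty)^8$ of $\pi_0$ and continuous maps $\pi\mapsto E^\dagger(\pi),E_+(\pi),E_-(\pi)$ on $U$, taking the values $E^\dagger,E_+,E_-$ at $\pi_0$, such that for every $\pi\in U$ the points $E^\dagger(\pi)$ (with $L=R=0$), $E_+(\pi)$ and $E_-(\pi)$ (both with $L,R>0$) are hyperbolic equilibria of the frozen system with parameters $\pi$, where $E^\dagger(\pi)$ and $E_+(\pi)$ are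 locally asymptotically stable and $E_-(\pi)$ is a saddle with exactly one unstable direction.
   Context: The state space is the simplex $\mathcal T=\{(L,R,A)\in\mathbb R^3: L\ge0,R\ge0,A\ge0,L+R+A\le1\}$, and $$K=\begin{pmatrix}\alpha_L&\gamma_{RL}\\ \gamma_{LR}&\alpha_R\end{pmatrix},\quad M=\begin{pmatrix}\mu_L&0\\0&\mu_R\end{pmatrix},\quad D=\begin{pmatrix}\delta_L&0\\0&\delta_R\end{pmatrix},\quad \mathbf 1=(1,1)^\top.$$ The symmetry assumptions are $\alpha_L=\alpha_R=\alpha$, $\gamma_{LR}=\gamma_{RL}=\gamma$, $\mu_L=\mu_R=\mu$, $\delta_L=\delta_R=\delta$. An equilibrium is hyperbolic if its Jacobian has no eigenvalue on the imaginary axis; a saddle with exactly one unstable direction has exactly one eigenvalue with positive real part and the other two with negative real part. *)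

(* Defs.v *)
From HB Require Import structures.
From mathcomp Require Import all_boot all_order all_algebra.
From mathcomp Require Import all_classical all_reals all_analysis.
From mathcomp Require Import complex.

Set Implicit Arguments.
Unset Strict Implicit.
Unset Printing Implicit Defensive.

Import Order.TTheory GRing.Theory Num.Theory.
Import numFieldNormedType.Exports.

Local Open Scope classical_set_scope.
Local Open Scope ring_scope.

Section ExplicitMatrices.
Variable R : realType.

Definition row3 (a b c : R) : 'rV[R]_3 := \row_(i < 3) [:: a; b; c]`_i.

Definition mx22 (a b c d : R) : 'M[R]_2 :=
  \matrix_(i < 2, j < 2) (nth [::] [:: [:: a; b]; [:: c; d]] i)`_j.

End ExplicitMatrices.

Section FrozenSystem.
Variable R : realType.

(* The parameter vector, in the order
   (alpha_L, alpha_R, gamma_LR, gamma_RL, mu_L, mu_R, delta_L, delta_R). *)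
Definition params (aL aR gLR gRL mL mR dL dR : R) : 'rV[R]_8 :=
  \row_(i < 8) [:: aL; aR; gLR; gRL; mL; mR; dL; dR]`_i.

Definition positive_params : set 'rV[R]_8 := [set p | forall i, 0 < p 0 i].

Definition matK (p : 'rV[R]_8) : 'M[R]_2 := mx22 (p 0 0) (p 0 3) (p 0 2) (p 0 1).
Definition matM (p : 'rV[R]_8) : 'M[R]_2 := mx22 (p 0 4) 0 0 (p 0 5).
Definition matD (p : 'rV[R]_8) : 'M[R]_2 := mx22 (p 0 6) 0 0 (p 0 7).

(* A state is the row vector (L, R, A). *)
Definition simplexT : set 'rV[R]_3 :=
  [set x | [/\ 0 <= x 0 0, 0 <= x 0 1, 0 <= x 0 2 & x 0 0 + x 0 1 + x 0 2 <= 1]].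

Definition frozen_field (eta rho : R) (p : 'rV[R]_8) (x : 'rV[R]_3) : 'rV[R]_3 :=
  let v : 'cV[R]_2 := \col_(i < 2) [:: x 0 0; x 0 1]`_i in
  let A := x 0 2 in
  let ones : 'cV[R]_2 := const_mx 1 in
  let C := 1 - (ones^T *m v) 0 0 - A in
  let dv := (C *: matK p + A *: matD p - matM p) *m v in
  let dA := eta * C - A * (ones^T *m matD p *m v) 0 0 - rho * A in
  row3 (dv 0 0) (dv 1 0) dA.

End FrozenSystem.

Section Equilibria.
Variable R : realType.
Implicit Types (f : 'rV[R]_3 -> 'rV[R]_3) (E : 'rV[R]_3).

(* The field is defined on the whole space, so membership in the state space
   is part of being an equilibrium. *)
Definition equilibrium f E := simplexT E /\ f E = 0.

(* ['J f E] acts on row vectors, so it is the transpose of the usual Jacobian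
   matrix; the two have the same eigenvalues, with the same multiplicities. *)
Definition complex_jacobian f E : 'M[R[i]]_3 := map_mx (real_complex R) ('J f E).

Definition hyperbolic f E :=
  forall z : R[i], eigenvalue (complex_jacobian f E) z -> complex.Re z != 0.

Definition hyperbolic_equilibrium f E := equilibrium f E /\ hyperbolic f E.

(* [s] lists the complex eigenvalues with algebraic multiplicity. *)
Definition saddle_one_unstable f E :=
  exists s : seq R[i],
    [/\ char_poly (complex_jacobian f E) = \prod_(z <- s) ('X - z%:P),
        count (fun z : R[i] => 0 < complex.Re z) s = 1%N
      & count (fun z : R[i] => complex.Re z < 0) s = 2%N].

(* [x] solves x' = f(x) on the interval from 0 (included) to the bound [b]. *)
Definition solution f (b : itv_bound R) (x : R -> 'rV[R]_3) :=
  {within [set` Interval (BLeft 0) b], continuous x} /\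
  forall t : R, t \in Interval (BRight 0) b -> is_derive t 1 x (f (x t)).

(* Solutions on bounded intervals are included, so that a solution starting
   near [E] stays near [E] as long as it exists. *)
Definition lyapunov_stable f E :=
  forall eps : R, 0 < eps -> exists2 delta : R, 0 < delta &
    forall (T : R) (x : R -> 'rV[R]_3),
      solution f (BLeft T) x -> `|x 0 - E| < delta ->
      forall t : R, t \in `[0, T[ -> `|x t - E| < eps.

Definition locally_attractive f E :=
  exists2 delta : R, 0 < delta &
    forall x : R -> 'rV[R]_3,
      solution f +oo%O x -> `|x 0 - E| < delta -> x t @[t --> +oo%R] --> E.

Definition locally_asymptotically_stable f E :=
  lyapunov_stable f E /\ locally_attractive f E.

End Equilibria.

(* Main.v *)
Require Import Defs.
From HB Require Import structures.
From mathcomp Require Import all_boot all_order all_algebra.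
From mathcomp Require Import all_classical all_reals all_analysis.
From mathcomp Require Import complex.
From mathcomp Require polyrcf.
From mathcomp Require Import ring lra.

Set Implicit Arguments.
Unset Strict Implicit.
Unset Printing Implicit Defensive.

Import Order.TTheory GRing.Theory Num.Theory.
Import numFieldNormedType.Exports.

Local Open Scope classical_set_scope.
Local Open Scope ring_scope.

(** The field is quadratic in the state, so that it satisfies the midpoint
    formula [f x - f y = (x - y) *m J ((x + y) / 2)], where [J] is the Jacobian
    matrix and states are row vectors ([frozen_midpoint]). This exact identity
    replaces every Taylor estimate.

    Persistence. The radical-free state is an equilibrium for all parameters.
    At the two other baseline equilibria the determinant of [J] does not vanish,
    and by the midpoint formula the simplified Newton iteration is a uniform
    contraction; its fixed point depends continuously on the parameters
    ([implicit_zero]).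

    Stable equilibria. Call [J] contracting for a positive definite quadratic
    form if the form decreases along the linear flow of [J] at a definite rate.
    This is an open condition on [J] ([contracting_near]), it puts the spectrum
    in the open left half-plane ([eigenvalue_contracting]), and, if it holds for
    all states near an equilibrium, the midpoint formula makes the form a strict
    Lyapunov function ([contracting_asymptotically_stable]). So a single form,
    chosen at the baseline, serves for all nearby parameters. The symmetric
    baseline decouples in the coordinates [L + R], [L - R] and [A], where a
    diagonal form can be written down for [(0, 0, 4/5)] and for
    [(1/12, 1/12, 10/21)].

    Saddle. A real matrix of order three with negative trace and positive
    determinant has one positive eigenvalue and two eigenvalues with negative
    real part ([char_poly_one_unstable]). Both inequalities are open and hold at
    [(3/40, 3/40, 1/2)].

    All the requirements hold near the baseline, and the neighbourhood is the
    interior of the set of parameters that meet them. *)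

(** * Matrices, the sup norm and Jacobian matrices *)

Section SupNorm.
Variable R : realType.

Lemma entry_le_norm m n (M : 'M[R]_(m, n)) i j : `|M i j| <= `|M|.
Proof.
rewrite [leRHS]/Num.Def.normr/= mx_normrE.
exact: (le_bigmax _ (fun ij : 'I_m * 'I_n => `|M ij.1 ij.2|) (i, j)).
Qed.

Lemma norm_le_entries m n (c : R) (M : 'M[R]_(m, n)) :
  0 <= c -> (forall i j, `|M i j| <= c) -> `|M| <= c.
Proof.
move=> c0 Mc; rewrite [leLHS]/Num.Def.normr/= mx_normrE.
by apply: bigmax_le => // -[i j] _ /=.
Qed.

Lemma norm_mulmx_le n p (h : 'rV[R]_n) (M : 'M[R]_(n, p)) :
  `|h *m M| <= n%:R * `|h| * `|M|.
Proof.
apply: norm_le_entries => [|i j]; first by rewrite !mulr_ge0.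
rewrite mxE (le_trans (ler_norm_sum _ _ _))//.
apply: (@le_trans _ _ (\sum_(k < n) `|h| * `|M|)).
  by apply: ler_sum => k _; rewrite normrM ler_pM// entry_le_norm.
by rewrite sumr_const card_ord -mulrA mulr_natl.
Qed.

Lemma cvg_entries (T : Type) (F : set_system T) {FF : Filter F} m n
    (f : T -> 'M[R]_(m, n)) (l : 'M[R]_(m, n)) :
  (forall i j, f x i j @[x --> F] --> l i j) -> f x @[x --> F] --> l.
Proof.
move=> fl; apply/cvgrPdist_le => e e0; near=> x.
apply: norm_le_entries => [|i j]; first exact: ltW.
rewrite !mxE; move: i j; near: x.
apply: filter_forall => i; apply: filter_forall => j.
by move/cvgrPdist_le : (fl i j); apply.
Unshelve. all: by end_near. Qed.

End SupNorm.

Section Caratheodory.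
Variable R : realType.

(** A linear map approximating the increments of [f] at [x] up to a relative
    error tending to zero is the differential of [f] at [x]. *)
Lemma diff_relative_error (V W : normedModType R) (f : V -> W)
    (df : {linear V -> W}) (e : V -> R) x :
  continuous df ->
  (forall h, `|f (h + x) - f x - df h| <= e h * `|h|) ->
  e h @[h --> (0 : V)] --> (0 : R) ->
  differentiable f x /\ 'd f x = df :> (V -> W).
Proof.
move=> dfc err e0.
have loc : f \o shift x = cst (f x) + df +o_ (0 : V) id.
  apply/eqaddoP => eps eps0; near=> h => /=.
  rewrite !fctE opprD addrA; apply: le_trans (err h) _.
  rewrite ler_wpM2r//; near: h.
  move/cvgrPdist_le : e0 => /(_ _ eps0); apply: filterS => h.
  by rewrite sub0r normrN => /(le_trans (ler_norm _)).
have dE : 'd f x = df :> (V -> W) by exact: diff_unique.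
by split=> //; apply/diff_locallyP; rewrite dE.
Unshelve. all: by end_near. Qed.

Lemma continuous_mulmxr n p (M : 'M[R]_(n, p)) :
  continuous (mulmxr M : 'rV[R]_n -> 'rV[R]_p).
Proof.
apply: bounded_linear_continuous; apply/linear_boundedP.
near=> r => x; rewrite /= (le_trans (norm_mulmx_le _ _))// mulrAC.
rewrite ler_wpM2r//; near: r; apply: nbhs_pinfty_ge; exact: num_real.
Unshelve. all: by end_near. Qed.

(** Carathéodory's characterization: a slope matrix continuous at [x] takes
    the value of the Jacobian matrix there. *)
Lemma jacobian_slope m n (f : 'rV[R]_m -> 'rV[R]_n)
    (S : 'rV[R]_m -> 'M[R]_(m, n)) x :
  (forall y, f y - f x = (y - x) *m S y) -> {for x, continuous S} ->
  'J f x = S x.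
Proof.
move=> fS cS.
have [||_ dE] := @diff_relative_error _ _ f (mulmxr (S x))
  (fun h => m%:R * `|S (h + x) - S x|) x (@continuous_mulmxr _ _ _).
- move=> h /=; rewrite fS addrK -mulmxBr (le_trans (norm_mulmx_le _ _))//.
  by rewrite mulrAC.
- have /subr_cvg0 Sx0 : S (h + x) @[h --> (0 : 'rV[R]_m)] --> S x.
    by move: cS; rewrite continuous_shift forE /continuous_at /= add0r.
  rewrite -[X in _ --> X](mulr0 m%:R) -(normr0 'M[R]_(m, n)).
  exact: (cvgM (cvg_cst _) (cvg_norm Sx0)).
by apply/row_matrixP => i; rewrite !rowE /jacobian mul_rV_lin1 /= dE.
Qed.

End Caratheodory.

(** * Lyapunov's direct method *)

Section Lyapunov.
Variable R : realType.

(** First-exit argument: the derivative is only controlled below the level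
    [c], yet a function starting below that level never reaches it. *)
Lemma sublevel_trapping (W : R -> R) (t c : R) :
  {within `[0, t], continuous W} ->
  {in `]0, t[, forall s : R, derivable W s 1} ->
  {in `]0, t[, forall s : R, W s < c -> 'D_1 W s <= 0} ->
  W 0 < c -> {in `[0, t], forall s, W s < c}.
Proof.
move=> cW dW W'le0 W0c s0; rewrite in_itv/= => /andP[s0_ge0 s0t].
rewrite ltNge; apply/negP => cWs0.
pose A := [set s | 0 <= s <= s0 /\ c <= W s].
have As0 : A s0 by split; rewrite ?s0_ge0 ?lexx.
have lbA : has_lbound A by exists 0 => s [/andP[]].
have infA : has_inf A by split => //; exists s0.
set s1 := inf A.
have s1_ge0 : 0 <= s1 by apply: lb_le_inf; [exists s0|move=> s [/andP[]]].
have s1s0 : s1 <= s0 by exact: (ge_inf lbA As0).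
have below s : 0 <= s -> s < s1 -> W s < c.
  move=> s_ge0 ss1; rewrite ltNge; apply/negP => cWs.
  have : A s by split; rewrite // s_ge0 (le_trans (ltW ss1)).
  by move/(ge_inf lbA); rewrite leNgt ss1.
have Ws1 : W s1 < c.
  apply: le_lt_trans W0c.
  have := @ler0_derive1_le_cc R W 0 s1; apply => //.
  - move=> s /[!in_itv]/= /andP[s_gt0 ss1].
    by apply: dW; rewrite in_itv/= s_gt0 (lt_le_trans ss1)// (le_trans s1s0).
  - move=> s /[!in_itv]/= /andP[s_gt0 ss1].
    rewrite derive1E; apply: W'le0; last by rewrite below// ltW.
    by rewrite in_itv/= s_gt0 (lt_le_trans ss1)// (le_trans s1s0).
  - apply: continuous_subspaceW cW => s /=; rewrite !in_itv/= => /andP[-> ss1].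
    by rewrite (le_trans ss1)// (le_trans s1s0).
  - by rewrite in_itv/= lexx s1_ge0.
  - by rewrite in_itv/= lexx s1_ge0.
have : \forall s \near s1, `[0, t]%classic s -> W s < c.
  have s1t : `[0, t]%classic s1 by rewrite /= in_itv/= s1_ge0 (le_trans s1s0).
  by move/subspace_continuousP : cW => /(_ _ s1t)/cvgr_lt; apply.
move/nbhs_ballP => [e /= e0 se].
have [s [/andP[s_ge0 ss0] cWs] ss1] := inf_adherent e0 infA.
have s1s : s1 <= s by apply: ge_inf => //; split; rewrite ?s_ge0.
suff : W s < c by rewrite ltNge cWs.
apply: se => /=; last by rewrite in_itv/= s_ge0 (le_trans ss0).
by rewrite /ball/= ler0_norm ?subr_le0// opprB ltrBlDl.
Qed.


Section AlongSolutions.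
Variables (f : 'rV[R]_3 -> 'rV[R]_3) (b : itv_bound R).
Variables (x : R -> 'rV[R]_3) (V : 'rV[R]_3 -> R).
Hypotheses (fx : solution f b x) (dV : forall y, differentiable V y).
Variable t : R.
Hypothesis tb : t \in Interval (BLeft 0) b.

Lemma continuous_along : {within `[0, t], continuous (V \o x)}.
Proof.
have [cx _] := fx.
apply: (@continuous_subspaceW _ _ _ [set` Interval (BLeft 0) b]).
  move=> s /=; rewrite !itv_boundlr => /andP[-> st].
  by move: tb; rewrite itv_boundlr => /andP[_]; exact: le_trans.
apply/subspace_continuousP => s bs.
move/subspace_continuousP : cx => /(_ s bs) cxs.
have dVs := differentiable_continuous (dV (x s)).
exact: (@cvg_comp _ _ _ x V _ _ _ cxs dVs).
Qed.

Lemma is_derive_along : {in `]0, t[, forall s : R,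
  is_derive s 1 (V \o x) ('d V (x s) (f (x s)))}.
Proof.
move=> s; rewrite itv_boundlr => /andP[s0 st].
have [_ /(_ s)] := fx; rewrite itv_boundlr s0/= => dx.
have {}dx : is_derive s 1 x (f (x s)).
  apply: dx; move: tb; rewrite itv_boundlr => /andP[_]; apply: le_trans.
  by move: st; rewrite !bnd_simp => /ltW.
have xs : differentiable x s by apply/derivable1_diffP.
have Vxs : differentiable (V \o x) s by exact: differentiable_comp.
split; first exact/derivable1_diffP.
rewrite (deriveE _ Vxs) (diff_comp xs (dV _)) /=.
by rewrite -(deriveE _ xs) derive_val.
Qed.

End AlongSolutions.

(** Lyapunov's direct method: [V] dominates a multiple of the square of the
    distance to [E] and decays at a rate proportional to itself near [E]. *)
Lemma lyapunov_asymptotically_stable (f : 'rV[R]_3 -> 'rV[R]_3) E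
    (V : 'rV[R]_3 -> R) (c k r : R) :
  0 < c -> 0 < k -> 0 < r ->
  (forall y, differentiable V y) -> V E = 0 ->
  (forall y, c * `|y - E| ^+ 2 <= V y) ->
  (forall y, `|y - E| < r -> 'd V y (f y) <= - k * V y) ->
  locally_asymptotically_stable f E.
Proof.
move=> c0 k0 r0 dV VE cV V'.
have V_ge0 y : 0 <= V y by apply: le_trans (cV y); rewrite mulr_ge0// ltW.
have stable eps : 0 < eps -> exists2 d, 0 < d & forall b x, solution f b x ->
    `|x 0 - E| < d -> {in Interval (BLeft 0) b, forall t, `|x t - E| < eps}.
  move=> eps0; pose e := Num.min eps r.
  have e0 : 0 < e by rewrite lt_min eps0.
  have ce0 : 0 < c * e ^+ 2 by rewrite mulr_gt0// exprn_gt0.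
  have close y : V y < c * e ^+ 2 -> `|y - E| < e.
    move=> /(le_lt_trans (cV y)); rewrite ltr_pM2l//.
    by rewrite ltr_pXn2r// nnegrE// ltW.
  have : \forall y \near E, V y < c * e ^+ 2.
    have /cvgr_lt := differentiable_continuous (dV E).
    by apply; rewrite VE.
  move=> /nbhs_ballP[d /= d0 dVc]; exists d => // b x fx x0d t tb.
  have W0 : V (x 0) < c * e ^+ 2.
    by apply: dVc; rewrite -ball_normE /ball_/= distrC.
  suff /close : V (x t) < c * e ^+ 2 by rewrite lt_min => /andP[].
  have t0 : 0 <= t by move: tb; rewrite itv_boundlr bnd_simp => /andP[].
  apply: (@sublevel_trapping (V \o x) t _ _ _ _ W0).
  - exact: (continuous_along fx).
  - by move=> s /(is_derive_along fx dV tb)[].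
  - move=> s /(is_derive_along fx dV tb) sD /close; rewrite lt_min => /andP[_ sr].
    rewrite derive_val (le_trans (V' _ sr))// mulNr oppr_le0 mulr_ge0//.
    exact: ltW.
  - by rewrite in_itv/= t0 lexx.
split=> [eps /stable[d d0 dx]|].
  by exists d => // T x; exact: dx.
have [d d0 dr] := stable _ r0; exists d => // x fx x0d.
have inr t : 0 <= t -> `|x t - E| < r.
  by move=> t0; apply: (dr _ _ fx x0d); rewrite in_itv/= t0.
(* [V (1 + k t)] is nonincreasing along the solution, because
   [V' (1 + k t) + k V <= - k ^ 2 t V]. *)
have decay t : 0 <= t -> V (x t) * (1 + k * t) <= V (x 0).
  move=> t0; have tb : t \in Interval (BLeft 0) +oo%O by rewrite in_itv/= t0.
  pose g s := V (x s) * (1 + k * s).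
  have gD : {in `]0, t[, forall s : R, is_derive s 1 g
      (V (x s) * k + (1 + k * s) * 'd V (x s) (f (x s)))}.
    move=> s /(is_derive_along fx dV tb) sD.
    have lD : is_derive s 1 (fun s : R => 1 + k * s) k.
      by apply: is_derive_eq; rewrite add0r mul1r [LHS]mulr1.
    by have := is_deriveM sD lD.
  have -> : V (x 0) = g 0 by rewrite /g mulr0 addr0 mulr1.
  apply: (@ler0_derive1_le_cc R g 0 t) => //.
  - by move=> s /gD[].
  - move=> s /[dup] st /gD sD; rewrite derive1E derive_val.
    move: st; rewrite in_itv/= => /andP[s0 _].
    have ks : 0 < 1 + k * s by rewrite addr_gt0// mulr_gt0.
    have := V' _ (inr _ (ltW s0)).
    rewrite -(ler_pM2l ks) => /(lerD (lexx (V (x s) * k)))/le_trans; apply.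
    rewrite -oppr_ge0 [leRHS](_ : _ = k ^+ 2 * s * V (x s)); last by ring.
    by rewrite !mulr_ge0// ?exprn_ge0// ltW.
  - have lc : continuous (fun s : R => 1 + k * s).
      by move=> s; apply: cvgD; [exact: cvg_cst|apply: cvgM; [exact: cvg_cst|]].
    apply/subspace_continuousP => s st.
    have /subspace_continuousP/(_ s st) Vxc := continuous_along fx dV tb.
    have lcs : 1 + k * u @[u --> within `[0, t] (nbhs s)] --> 1 + k * s.
      by apply: cvg_within_filter; exact: lc.
    exact: (@cvgM _ _ _ _ (V \o x) (fun s : R => 1 + k * s) _ _ Vxc lcs).
  - by rewrite in_itv/= lexx t0.
  - by rewrite in_itv/= lexx t0.
apply/cvgrPdist_lt => eps eps0; near=> t.
have t0 : 0 < t by near: t; apply: nbhs_pinfty_gt; exact: num_real.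
have kt : 0 < 1 + k * t by rewrite addr_gt0// mulr_gt0.
rewrite distrC -(@ltr_pXn2r _ 2)// ?nnegrE ?(ltW eps0)//.
rewrite -(ltr_pM2l c0) -(ltr_pM2r kt).
apply: le_lt_trans (_ : V (x 0) < _).
  by apply: le_trans (decay _ (ltW t0)); rewrite ler_pM2r.
have ce0 : 0 < c * eps ^+ 2 * k by rewrite !mulr_gt0// exprn_gt0.
apply: (@lt_trans _ _ (c * eps ^+ 2 * k * t)).
  rewrite mulrC -ltr_pdivrMr//; near: t; apply: nbhs_pinfty_gt; exact: num_real.
rewrite [ltRHS](_ : _ = c * eps ^+ 2 + c * eps ^+ 2 * k * t); last by ring.
by rewrite ltrDr mulr_gt0// exprn_gt0.
Unshelve. all: by end_near. Qed.

End Lyapunov.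

(** * Quadratic forms contracted by a matrix *)

Section QuadraticForm.
Variable R : realType.

(** The bilinear form with matrix [P], on row vectors. *)
Definition bform n (P : 'M[R]_n) (u v : 'rV[R]_n) : R := (u *m P *m v^T) 0 0.

Section FormTheory.
Variables (n : nat) (P : 'M[R]_n).
Implicit Types u v w h : 'rV[R]_n.

Lemma bformDl u v w : bform P (u + v) w = bform P u w + bform P v w.
Proof. by rewrite /bform !mulmxDl mxE. Qed.

Lemma bformDr u v w : bform P w (u + v) = bform P w u + bform P w v.
Proof. by rewrite /bform linearD mulmxDr mxE. Qed.

Lemma bformZr a u w : bform P w (a *: u) = a * bform P w u.
Proof. by rewrite /bform linearZ -scalemxAr mxE. Qed.

Lemma bform_sym u v : P^T = P -> bform P u v = bform P v u.
Proof.
move=> PT; rewrite /bform.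
have -> : v *m P *m u^T = (u *m P *m v^T)^T.
  by rewrite !trmx_mul trmxK PT mulmxA.
by rewrite [RHS]mxE.
Qed.

Lemma norm_bform_le u v : `|bform P u v| <= n%:R ^+ 2 * `|P| * (`|u| * `|v|).
Proof.
rewrite (le_trans (entry_le_norm _ _ _))// (le_trans (norm_mulmx_le _ _))//.
have vT : `|v^T| <= `|v|.
  by apply: norm_le_entries => // i j; rewrite mxE entry_le_norm.
rewrite (le_trans (ler_pM _ _ (lexx _) vT))// ?mulr_ge0//.
rewrite [leRHS](_ : _ = n%:R * (n%:R * `|u| * `|P|) * `|v|); last by ring.
by rewrite ler_wpM2r// ler_wpM2l// norm_mulmx_le.
Qed.

Lemma diff_bform (E x : 'rV[R]_n) : P^T = P ->
  let V y := bform P (y - E) (y - E) in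
  differentiable V x /\ forall h, 'd V x h = 2 * bform P (x - E) h.
Proof.
move=> PT V; pose d h := 2 * bform P (x - E) h.
have d_lin : linear d.
  by move=> a u v; rewrite /d bformDr bformZr mulrDr mulrCA.
pose d_linear := GRing.isLinear.Build _ _ _ _ _ d_lin.
pose dl : {linear 'rV[R]_n -> R^o} := HB.pack d d_linear.
have dc : continuous dl.
  apply: bounded_linear_continuous; apply/linear_boundedP.
  near=> r => h; rewrite /dl/= /d.
  apply: (@le_trans _ _ (2 * (n%:R ^+ 2 * `|P| * `|x - E|) * `|h|)).
    by rewrite normrM ger0_norm// -!mulrA ler_wpM2l// !mulrA -(mulrA _ `|_|)
      norm_bform_le.
  by rewrite ler_wpM2r//; near: r; apply: nbhs_pinfty_ge; exact: num_real.
have [||dV dE] := @diff_relative_error _ _ R^o V dl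
  (fun h => n%:R ^+ 2 * `|P| * `|h|) x dc.
- move=> h; rewrite /V/= /d -(addrA h); set y := x - E.
  (* [y] must be opaque, lest the form be expanded along [x - E] as well *)
  move: y => y; rewrite !(bformDl, bformDr) (bform_sym h y)//.
  rewrite [X in `|X|](_ : _ = bform P h h).
    by rewrite (le_trans (norm_bform_le _ _))// mulrA.
  by ring.
- rewrite -[X in _ --> X](mulr0 (n%:R ^+ 2 * `|P|)) -(normr0 'rV[R]_n).
  exact: (cvgM (cvg_cst _) (cvg_norm cvg_id)).
by split=> // h; rewrite dE.
Unshelve. all: by end_near. Qed.

End FormTheory.

(** For a symmetric matrix [P], the matrices [J] such that half the derivative
    of the form [P] along the linear flow [h' = h *m J] is at most
    [- c * `|h| ^+ 2]. *)
Definition contracting n (P : 'M[R]_n) (c : R) : set 'M[R]_n :=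
  [set J | forall h : 'rV[R]_n, bform P h (h *m J) <= - c * `|h| ^+ 2].

Lemma contracting_near n (P J0 : 'M[R]_n) (c c' : R) :
  c' < c -> contracting P c J0 -> \forall J \near J0, contracting P c' J.
Proof.
move=> cc' cJ0; pose K : R := n%:R ^+ 2 * `|P| * n%:R + 1.
have K0 : 0 < K by rewrite ltr_wpDl// !mulr_ge0// exprn_ge0.
near=> J => h; rewrite -(subrK J0 J) mulmxDr bformDr.
have JJ0 : `|J - J0| <= (c - c') / K.
  rewrite distrC; near: J; apply: cvgr_dist_le; first exact: cvg_id.
  by rewrite divr_gt0// subr_gt0.
rewrite [leRHS](_ : _ = (c - c') * `|h| ^+ 2 + - c * `|h| ^+ 2); last by ring.
apply: lerD; last exact: cJ0.
rewrite (le_trans (ler_norm _))// (le_trans (norm_bform_le _ _ _))//.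
apply: (@le_trans _ _ (n%:R ^+ 2 * `|P| * (`|h| * (n%:R * `|h| * `|J - J0|)))).
  by rewrite ler_wpM2l ?mulr_ge0 ?exprn_ge0// ler_wpM2l// norm_mulmx_le.
rewrite [leLHS](_ : _ = (K - 1) * `|J - J0| * `|h| ^+ 2); last first.
  by rewrite /K; ring.
rewrite ler_wpM2r ?exprn_ge0//.
move: JJ0; rewrite ler_pdivlMr// mulrC; apply: le_trans.
by rewrite ler_wpM2r// gerBl.
Unshelve. all: by end_near. Qed.

Lemma eigenvalue_contracting n (P J : 'M[R]_n) (c : R) (z : R[i]) :
  P^T = P -> (forall h, h != 0 -> 0 < bform P h h) -> 0 < c ->
  contracting P c J -> eigenvalue (map_mx (real_complex R) J) z ->
  complex.Re z < 0.
Proof.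
move=> PT P0 c0 cJ /eigenvalueP[v vJ v0].
pose a : 'rV[R]_n := \row_j complex.Re (v 0 j).
pose b : 'rV[R]_n := \row_j complex.Im (v 0 j).
have ReD : {morph @complex.Re R : x y / x + y >-> x + y} by case=> ? ? [].
have ImD : {morph @complex.Im R : x y / x + y >-> x + y} by case=> ? ? [].
(* real and imaginary parts of the eigenvector equation *)
have aJ : a *m J = complex.Re z *: a - complex.Im z *: b.
  apply/rowP => j.
  have /(congr1 (@complex.Re R)) := congr1 (fun w : 'rV_n => w 0 j) vJ.
  rewrite !mxE (big_morph _ ReD (erefl _)).
  under eq_bigr do rewrite mxE.
  case: z {vJ} (v 0 j) => x y [x' y'] /= <-; apply: eq_bigr => k _; rewrite mxE.
  by case: (v 0 k) => x1 y1 /=; rewrite mulr0 subr0.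
have bJ : b *m J = complex.Im z *: a + complex.Re z *: b.
  apply/rowP => j.
  have /(congr1 (@complex.Im R)) := congr1 (fun w : 'rV_n => w 0 j) vJ.
  rewrite !mxE (big_morph _ ImD (erefl _)).
  under eq_bigr do rewrite mxE.
  case: z {vJ aJ} (v 0 j) => x y [x' y'] /=; rewrite addrC => <-.
  apply: eq_bigr => k _; rewrite mxE.
  by case: (v 0 k) => x1 y1 /=; rewrite mulr0 add0r.
have [ab0|ab0] := boolP ((a == 0) && (b == 0)).
  case/andP : ab0 => /eqP a0 /eqP b0; case/negP : v0; apply/eqP/rowP => j.
  move/rowP : a0 => /(_ j); move/rowP : b0 => /(_ j); rewrite !mxE.
  by case: (v 0 j) => x y /= -> ->.
have form_ge0 h : 0 <= bform P h h.
  by have [->|/P0/ltW//] := eqVneq h 0; rewrite /bform !mul0mx mxE.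
have cge0 (h : 'rV[R]_n) : - c * `|h| ^+ 2 <= 0.
  by rewrite mulNr oppr_le0 mulr_ge0 ?exprn_ge0// ltW.
have clt0 (h : 'rV[R]_n) : h != 0 -> - c * `|h| ^+ 2 < 0.
  by move=> h0; rewrite mulNr oppr_lt0 mulr_gt0// exprn_gt0// normr_gt0.
(* the terms with the imaginary part of [z] cancel by symmetry *)
have : complex.Re z * (bform P a a + bform P b b) < 0.
  rewrite [ltLHS](_ : _ = bform P a (a *m J) + bform P b (b *m J)); last first.
    rewrite aJ bJ -scaleNr !(bformDr, bformZr) (bform_sym b a)//; ring.
  apply: (le_lt_trans (lerD (cJ a) (cJ b))).
  move: ab0; rewrite negb_and => /orP[a0|b0].
    by rewrite ltr_wnDr// clt0.
  by rewrite ltr_wnDl// clt0.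
rewrite pmulr_llt0//.
move: ab0; rewrite negb_and => /orP[a0|b0].
  by rewrite ltr_wpDr// P0.
by rewrite ltr_wpDl// P0.
Qed.

End QuadraticForm.

(** An equilibrium [E] is asymptotically stable if the slope matrices between
    [E] and all nearby states, not only the Jacobian matrix at [E], are
    contracting for one positive definite form, which is then a Lyapunov
    function. *)
Lemma contracting_asymptotically_stable (R : realType)
    (f : 'rV[R]_3 -> 'rV[R]_3) (E : 'rV[R]_3) (S : 'rV[R]_3 -> 'M[R]_3)
    (P : 'M[R]_3) (c1 c : R) :
  P^T = P -> 0 < c1 -> (forall h, c1 * `|h| ^+ 2 <= bform P h h) -> 0 < c ->
  (forall x, f x = (x - E) *m S x) ->
  (\forall x \near E, contracting P c (S x)) ->
  locally_asymptotically_stable f E.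
Proof.
move=> PT c10 P1 c0 fS /nbhs_ballP[r /= r0 cS].
pose K : R := 3%:R ^+ 2 * `|P| + 1.
have K0 : 0 < K by rewrite ltr_wpDl// mulr_ge0// exprn_ge0.
have dP y := diff_bform E y PT.
apply: (@lyapunov_asymptotically_stable R f E (fun y => bform P (y - E) (y - E))
  c1 (2 * c / K) r) => //.
- by rewrite divr_gt0// mulr_gt0.
- by move=> y; exact: (dP y).1.
- by rewrite subrr /bform !mul0mx mxE.
- move=> y yE; rewrite (dP y).2.
  have {}yE : ball E r y by rewrite -ball_normE /ball_/= distrC.
  rewrite fS [leRHS](_ : _ = 2 * - (c * (bform P (y - E) (y - E) / K)));
    last by ring.
  rewrite ler_pM2l// (le_trans (cS y yE _))// mulNr lerN2 ler_pM2l//.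
  rewrite ler_pdivrMr// mulrC.
  rewrite (le_trans (ler_norm _))// (le_trans (norm_bform_le _ _ _))//.
  by rewrite expr2 ler_wpM2r ?mulr_ge0// lerDl.
Qed.

(** * Saddles of order three *)

Section Saddle.
Variable R : realType.

(** Viète: a pair of complex numbers with negative real sum and positive real
    product lies in the open left half-plane. *)
Lemma Re_lt0_of_sum_prod (z1 z2 : R[i]) (s p : R) :
  z1 + z2 = s%:C%C -> z1 * z2 = p%:C%C -> s < 0 -> 0 < p ->
  complex.Re z1 < 0 /\ complex.Re z2 < 0.
Proof.
case: z1 z2 => x1 y1 [x2 y2] [xs ys] [xp yp] s0 p0 /=.
have y2E : y2 = - y1 by apply/eqP; rewrite -addr_eq0 addrC ys.
move: xp yp; rewrite y2E => xp yp.
have : y1 * (x2 - x1) = 0 by rewrite -yp; ring.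
move/eqP; rewrite mulf_eq0 => /orP[/eqP y10|].
  have x12 : 0 < x1 * x2 by rewrite y10 in xp; lra.
  have [x1_lt0|x1_ge0] := ltP x1 0.
    by split => //; move: x12; rewrite nmulr_rgt0.
  have x2_lt0 : x2 < 0 by lra.
  by move: x12; rewrite nmulr_lgt0// ltNge x1_ge0.
by rewrite subr_eq0 => /eqP x21; split; lra.
Qed.

Lemma monic_pos_root (p : {poly R}) : p \is monic -> p.[0] < 0 ->
  exists2 x, 0 < x & root p x.
Proof.
move=> /monicP pm p0; have [|b bp] := @polyrcf.poly_pinfty_gt_lc _ p.
  by rewrite pm.
have [||x /andP[x0 _] px] := @poly_ivt R p 0 (Num.max 0 b).
- by rewrite le_max lexx.
- by rewrite (ltW p0) (le_trans _ (bp _ _))// ?pm// le_max lexx orbT.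
exists x => //; rewrite lt_neqAle x0 andbT; apply: contraTneq px => <-.
by rewrite rootE lt_eqF.
Qed.

(** The determinant is the product and the trace the sum of the eigenvalues.
    The characteristic polynomial is negative at zero, so that some eigenvalue
    is real and positive; the other two have positive product and negative
    sum. *)
Lemma char_poly_one_unstable (M : 'M[R]_3) : \tr M < 0 -> 0 < \det M ->
  exists s : seq R[i],
    [/\ char_poly (map_mx (real_complex R) M) = \prod_(z <- s) ('X - z%:P),
        count (fun z : R[i] => 0 < complex.Re z) s = 1%N
      & count (fun z : R[i] => complex.Re z < 0) s = 2%N].
Proof.
move=> tr0 det0; set p := char_poly _.
have pE : p = map_poly (real_complex R) (char_poly M) by rewrite map_char_poly.
have [l l0 pl] : exists2 l, 0 < l & root (char_poly M) l.
  apply: monic_pos_root; first exact: char_poly_monic.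
  by rewrite horner_coef0 char_poly_det -signr_odd mulN1r oppr_lt0.
have [s ps] := closed_field_poly_normal p.
move: ps; rewrite (monicP (char_poly_monic _)) scale1r => ps.
have ls : l%:C%C \in s by rewrite -root_prod_XsubC -ps pE fmorph_root.
have sz : size s = 3%N.
  apply: succn_inj; rewrite -(size_prod_XsubC s id) -ps.
  exact: size_char_poly.
have [z1 [z2 sE]] : exists z1 z2, perm_eq s [:: l%:C%C; z1; z2].
  have := perm_to_rem ls; move: (size_rem ls); rewrite sz.
  by case: (rem _ s) => [|z1 [|z2 [|]]]//= _ sE; exists z1, z2.
have {}ps : p = \prod_(z <- [:: l%:C%C; z1; z2]) ('X - z%:P).
  by rewrite ps; exact: perm_big.
have p0 : l%:C%C * (z1 * z2) = (\det M)%:C%C.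
  have := char_poly_det (map_mx (real_complex R) M); rewrite -/p ps.
  rewrite coef0_prod_XsubC det_map_mx !big_cons big_nil mulr1.
  by move=> /(mulrI (unitrX _ (unitrN1 _))).
have p2 : l%:C%C + (z1 + z2) = (\tr M)%:C%C.
  have := char_poly_trace (map_mx (real_complex R) M) isT; rewrite -/p ps.
  rewrite (coefPn_prod_XsubC (ps := [:: _; _; _]))// => /oppr_inj.
  by rewrite !big_cons big_nil addr0 => ->; rewrite trace_map_mx.
have z12D : z1 + z2 = (\tr M - l)%:C%C.
  by rewrite -(addKr l%:C%C (z1 + z2)) p2 -rmorphN -rmorphD addrC.
have z12M : z1 * z2 = (\det M / l)%:C%C.
  have lC : l%:C%C != 0 by rewrite fmorph_eq0 gt_eqF.
  by apply: (mulfI lC); rewrite p0 -rmorphM/= mulrC divfK// gt_eqF.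
have [|z1_lt0 z2_lt0] := Re_lt0_of_sum_prod z12D z12M _ (divr_gt0 det0 l0).
  by lra.
exists [:: l%:C%C; z1; z2]; split=> //=.
  by rewrite l0 !ltNge !ltW.
by rewrite z1_lt0 z2_lt0 ltNge ltW.
Qed.

Lemma saddle_hyperbolic (f : 'rV[R]_3 -> 'rV[R]_3) E :
  saddle_one_unstable f E -> hyperbolic f E.
Proof.
move=> [s [ps s_gt0 s_lt0]] z; rewrite eigenvalue_root_char ps root_prod_XsubC.
have sz : size s = 3%N.
  apply: succn_inj; rewrite -(size_prod_XsubC s id) -ps.
  exact: size_char_poly.
pose pos (w : R[i]) := 0 < complex.Re w.
pose neg (w : R[i]) := complex.Re w < 0.
have disj : count (predI pos neg) s = 0%N.
  rewrite -(count_pred0 s); apply: eq_count => w /=.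
  by apply/negP => /andP[w_gt0]; rewrite /neg ltNge ltW.
have : count (predU pos neg) s == size s.
  by rewrite -[count _ _]addn0 -disj count_predUI s_gt0 s_lt0 sz.
rewrite -all_count => /allP sne0 /sne0 /=.
by case/orP; [move/gt_eqF|move/lt_eqF] => ->.
Qed.

End Saddle.

(** * Continuation of nondegenerate zeros *)

(** A zero of [F p0] with invertible Jacobian matrix extends to zeros of [F p]
    depending continuously on [p]. The midpoint formula, an identity for a map
    quadratic in the state, makes the simplified Newton iteration
    [x - F p x *m invmx (J p0 E0)] a contraction near [E0]; the zero of [F p]
    is its fixed point. *)
Lemma implicit_zero (R : realType) m n
    (F : 'rV[R]_m -> 'rV[R]_n -> 'rV[R]_n) (J : 'rV[R]_m -> 'rV[R]_n -> 'M[R]_n)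
    (p0 : 'rV[R]_m) (E0 : 'rV[R]_n) :
  (forall p x y, F p x - F p y = (x - y) *m J p (2^-1 *: (x + y))) ->
  {for (p0, E0), continuous (fun z => J z.1 z.2)} ->
  (forall x, continuous (F ^~ x)) ->
  F p0 E0 = 0 -> J p0 E0 \in unitmx ->
  exists E : 'rV[R]_m -> 'rV[R]_n, E p0 = E0 /\
    \forall p \near p0, {for p, continuous E} /\ F p (E p) = 0.
Proof.
move=> FJ cJ cF F0 uJ; pose B := invmx (J p0 E0).
pose K : R := n%:R ^+ 2 * `|B| + 1.
have K0 : 0 < K by rewrite ltr_wpDl// mulr_ge0// exprn_ge0.
(* for [M] near [J p0 E0] a Newton step contracts by the factor [1/2] *)
have half (h : 'rV[R]_n) M : `|J p0 E0 - M| <= (2 * K)^-1 ->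
    `|h - h *m M *m B| <= 2^-1 * `|h|.
  move=> MJ; rewrite -{1}[h](mulmxK uJ) -/B -mulmxBl -mulmxBr.
  rewrite (le_trans (norm_mulmx_le _ _))//.
  apply: (@le_trans _ _ (n%:R * (n%:R * `|h| * `|J p0 E0 - M|) * `|B|)).
    by rewrite ler_wpM2r// ler_wpM2l// norm_mulmx_le.
  rewrite [leLHS](_ : _ = (K - 1) * `|J p0 E0 - M| * `|h|); last first.
    by rewrite /K; ring.
  rewrite ler_wpM2r//; apply: (@le_trans _ _ (K * (2 * K)^-1)); last first.
    by rewrite invfM mulrCA divff ?mulr1// gt_eqF.
  by rewrite ler_pM// ?gerBl// /K addrK mulr_ge0// exprn_ge0.
have : \forall z \near (p0, E0), `|J p0 E0 - J z.1 z.2| <= (2 * K)^-1.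
  by move/cvgrPdist_le : cJ => /(_ (2 * K)^-1); apply; rewrite invr_gt0 mulr_gt0.
move=> [[U V] /= [p0U E0V] UV].
have [r r0 rV] : exists2 r, 0 < r & forall x, `|E0 - x| <= r -> V x.
  move/nbhs_ballP : E0V => [e /= e0 eV].
  exists (e / 2); first by rewrite divr_gt0.
  move=> x xe; apply: eV; rewrite -ball_normE /ball_/=.
  by rewrite (le_lt_trans xe)// ltr_pdivrMr// ltr_pMr// ltr1n.
pose D : set 'rV[R]_n := closed_ball_ Num.norm E0 r.
pose A := [set p | U p /\ `|F p E0 *m B| <= r / 2].
have nA : nbhs p0 A.
  apply: filterI => //.
  have FB : F p E0 *m B @[p --> p0] --> F p0 E0 *m B.
    have cB := @continuous_mulmxr R n n B (F p0 E0).
    exact: (@cvg_comp _ _ _ (F ^~ E0) (mulmxr B) _ _ _ (cF E0 p0) cB).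
  rewrite F0 mul0mx in FB.
  have r2 : 0 < r / 2 by rewrite divr_gt0.
  by move/cvgr0_norm_le : FB; apply.
pose T p x := x - F p x *m B.
have Tlip p x y : A p -> D x -> D y -> `|T p x - T p y| <= 2^-1 * `|x - y|.
  move=> [Up _] Dx Dy.
  rewrite [X in `|X|](_ : _ = x - y - (F p x - F p y) *m B); last first.
    by rewrite /T mulmxBl !opprD opprK addrACA.
  rewrite FJ; apply: half; apply: (UV (p, _)); split => //=; apply: rV.
  rewrite [X in `|X|](_ : _ = 2^-1 *: ((E0 - x) + (E0 - y))); last first.
    by apply/rowP => i; rewrite !mxE; lra.
  rewrite normrZ gtr0_norm// ler_pdivrMl//.
  by rewrite (le_trans (ler_normD _ _))// mulr_natl mulr2n lerD.
have DE0 : D E0 by rewrite /D /closed_ball_/= subrr normr0 ltW.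
have TD p : A p -> set_fun D D (T p).
  move=> Ap x Dx; rewrite /D /closed_ball_/= distrC.
  rewrite -(subrK (T p E0) (T p x)) -addrA.
  rewrite (le_trans (ler_normD _ _))// [leRHS](splitr r) lerD//.
    by rewrite (le_trans (Tlip _ _ _ _ _ _))// distrC mulrC ler_pM2r.
  by rewrite /T addrC addKr normrN; case: Ap.
have closedD : closed D by exact: closed_closed_ball_.
have ex p : A p -> exists x, D x /\ F p x = 0.
  move=> Ap; pose Tp := mkfun_fun (TD p Ap).
  (* row vectors form both a complete space and a normed module; the join of
     the two structures is built here *)
  pose X := HB.pack_for (completeNormedModType R) 'rV[R]_n
    (Complete.on 'rV[R]_n) (NormedModule.on 'rV[R]_n).
  have [||x Dx xT] := @banach_fixed_point R X D Tp _ closedD.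
  - exists 2^-1%:nng; split => /=; first by rewrite invf_lt1// ltr1n.
    by move=> [x y] [Dx Dy]; exact: Tlip.
  - by exists E0.
  exists x; split => //.
  have FB : F p x *m B = 0 by rewrite -[LHS](subKr x) -/(T p x) {1}xT subrr.
  by rewrite -[F p x](mulmxKV uJ) -/B FB mul0mx.
have uniq p x y : A p -> D x -> D y -> F p x = 0 -> F p y = 0 -> x = y.
  move=> Ap Dx Dy Fx Fy; have := Tlip p x y Ap Dx Dy.
  rewrite /T Fx Fy mul0mx !subr0 => xy; apply/eqP; rewrite -subr_eq0 -normr_le0.
  lra.
(* outside [A] the junk value [E0] is irrelevant *)
pose E p := xget E0 [set x | D x /\ F p x = 0].
have EP p : A p -> D (E p) /\ F p (E p) = 0.
  by move=> /ex /(xgetPex E0).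
exists E; split.
  have Ap0 := nbhs_singleton nA.
  by have [DE FE] := EP _ Ap0; exact: (uniq p0).
have := nbhs_interior nA; apply: filterS => p nAp.
have Ap := nbhs_singleton nAp; have [DEp FEp] := EP _ Ap; split => //.
pose L : R := 2 * n%:R * `|B| + 1.
have L0 : 0 < L by rewrite ltr_wpDl// !mulr_ge0.
have /cvgr0_norm_le FEp0 : F q (E p) @[q --> p] --> (0 : 'rV[R]_n).
  by rewrite -FEp; exact: (cF (E p)).
apply/(@cvgrPdist_le _ _ _ _ (nbhs_filter p)) => e e0.
near=> q.
have Aq : A q by near: q.
have [DEq FEq] := EP _ Aq.
have small : L * `|F q (E p)| <= e.
  rewrite mulrC -ler_pdivlMr//; near: q; apply: FEp0.
  by rewrite divr_gt0.
have FE0 : 0 <= `|F q (E p)| by [].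
apply: le_trans small.
have := Tlip q _ _ Aq DEp DEq; rewrite /T FEq mul0mx subr0.
have := norm_mulmx_le (F q (E p)) B.
have := ler_distD (E p - F q (E p) *m B) (E p) (E q).
rewrite subKr /L.
lra.
Unshelve. all: by end_near. Qed.

(** * The frozen field and its Jacobian matrix *)

Section SmallDimension.
Variable R : realType.

(** The matrix with rows [a b c], [d e f] and [g h i]. *)
Definition mx33 (a b c d e f g h i : R) : 'M[R]_3 :=
  \matrix_(j < 3, k < 3)
    (nth [::] [:: [:: a; b; c]; [:: d; e; f]; [:: g; h; i]] j)`_k.

Lemma ord3P (Q : 'I_3 -> Prop) : Q 0 -> Q 1 -> Q 2 -> forall i, Q i.
Proof.
move=> Q0 Q1 Q2 i; have := ltn_ord i.
case E : (nat_of_ord i) => [|[|[|]]]// _.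
- by have -> : i = 0 by exact: val_inj.
- by have -> : i = 1 by exact: val_inj.
- by have -> : i = 2 by exact: val_inj.
Qed.

Lemma sum_ord2 (F : 'I_2 -> R) : \sum_(i < 2) F i = F 0 + F 1.
Proof.
by rewrite !big_ord_recl big_ord0 addr0; congr (F _ + F _); exact: val_inj.
Qed.

Lemma sum_ord3 (F : 'I_3 -> R) : \sum_(i < 3) F i = F 0 + F 1 + F 2.
Proof.
rewrite !big_ord_recl big_ord0 addr0 addrA.
by congr (F _ + F _ + F _); exact: val_inj.
Qed.

Lemma row3E (a b c : R) :
  ((row3 a b c 0 0 = a) * (row3 a b c 0 1 = b) * (row3 a b c 0 2 = c))%type.
Proof. by rewrite !mxE. Qed.

Lemma mx33E (a b c d e f g h i : R) (M := mx33 a b c d e f g h i) :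
  ((M 0 0 = a) * (M 0 1 = b) * (M 0 2 = c) * (M 1 0 = d) * (M 1 1 = e) *
   (M 1 2 = f) * (M 2 0 = g) * (M 2 1 = h) * (M 2 2 = i))%type.
Proof. by rewrite /M !mxE. Qed.

Lemma det_mx33 (M : 'M[R]_3) : \det M =
  M 0 0 * (M 1 1 * M 2 2 - M 1 2 * M 2 1)
  - M 0 1 * (M 1 0 * M 2 2 - M 1 2 * M 2 0)
  + M 0 2 * (M 1 0 * M 2 1 - M 1 1 * M 2 0).
Proof.
pose m i j := M (inord i) (inord j).
have ME i j : M i j = m i j by rewrite /m !inord_val.
rewrite (expand_det_row _ 0) sum_ord3 /cofactor !(expand_det_row _ 0) !sum_ord2.
rewrite /cofactor !det_mx11 !mxE !ME /=.
by rewrite !(expr0, expr1, exprS)/=; ring.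
Qed.

Lemma sqr_norm_le3 (h : 'rV[R]_3) :
  `|h| ^+ 2 <= h 0 0 ^+ 2 + h 0 1 ^+ 2 + h 0 2 ^+ 2.
Proof.
set s := _ + _; have s0 : 0 <= s by rewrite !addr_ge0// sqr_ge0.
rewrite -(sqr_sqrtr s0) ler_pXn2r ?nnegrE ?sqrtr_ge0//.
apply: norm_le_entries => [|i]; first exact: sqrtr_ge0.
rewrite (ord1 i); apply: ord3P; rewrite -sqrtr_sqr ler_wsqrtr// /s.
- by rewrite -addrA lerDl addr_ge0// sqr_ge0.
- by rewrite addrAC lerDr addr_ge0// sqr_ge0.
- by rewrite lerDr addr_ge0// sqr_ge0.
Qed.

(** The quadratic form [k1 (L + R)^2 + k2 (L - R)^2 + k3 A^2]. *)
Definition mode_form (k1 k2 k3 : R) : 'M[R]_3 :=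
  mx33 (k1 + k2) (k1 - k2) 0 (k1 - k2) (k1 + k2) 0 0 0 k3.

Lemma form_modeE k1 k2 k3 (u v : 'rV[R]_3) : bform (mode_form k1 k2 k3) u v =
  k1 * (u 0 0 + u 0 1) * (v 0 0 + v 0 1)
  + k2 * (u 0 0 - u 0 1) * (v 0 0 - v 0 1) + k3 * u 0 2 * v 0 2.
Proof.
rewrite /bform mxE sum_ord3 ![(_ *m _) _ _]mxE !sum_ord3 ![_^T _ _]mxE.
by rewrite !mx33E; ring.
Qed.

Lemma mode_form_sym k1 k2 k3 : (mode_form k1 k2 k3)^T = mode_form k1 k2 k3.
Proof.
by apply/matrixP; apply: ord3P; apply: ord3P; rewrite mxE !mx33E.
Qed.

Lemma mode_form_ge k1 k2 k3 (h : 'rV[R]_3) : 1 <= k1 -> 1 <= k2 -> 1 <= k3 ->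
  1 * `|h| ^+ 2 <= bform (mode_form k1 k2 k3) h h.
Proof.
move=> k1_ge1 k2_ge1 k3_ge1; rewrite mul1r (le_trans (sqr_norm_le3 h))//.
rewrite form_modeE -!mulrA -!expr2.
have := ler_pM ler01 (sqr_ge0 (h 0 0 + h 0 1)) k1_ge1 (lexx _).
have := ler_pM ler01 (sqr_ge0 (h 0 0 - h 0 1)) k2_ge1 (lexx _).
have := ler_pM ler01 (sqr_ge0 (h 0 2)) k3_ge1 (lexx _).
have := sqr_ge0 (h 0 0); have := sqr_ge0 (h 0 1).
rewrite !mul1r; lra.
Qed.

End SmallDimension.

Section FrozenSystem.
Variables (R : realType) (eta rho : R).
Implicit Types (p : 'rV[R]_8) (x : 'rV[R]_3).

Lemma frozen_fieldE p x : frozen_field eta rho p x =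
  let C := 1 - x 0 0 - x 0 1 - x 0 2 in
  row3 ((C * p 0 0 + x 0 2 * p 0 6 - p 0 4) * x 0 0 + C * p 0 3 * x 0 1)
       (C * p 0 2 * x 0 0 + (C * p 0 1 + x 0 2 * p 0 7 - p 0 5) * x 0 1)
       (eta * C - x 0 2 * (p 0 6 * x 0 0 + p 0 7 * x 0 1) - rho * x 0 2).
Proof.
rewrite /frozen_field /=; congr row3; rewrite !(mxE, sum_ord2)/=; try ring.
Qed.

(** The Jacobian matrix acting on row vectors: the partial derivatives of the
    [j]-th component of the field form column [j]. *)
Definition frozen_jac p x : 'M[R]_3 :=
  let L := x 0 0 in let r := x 0 1 in let A := x 0 2 in
  let C := 1 - L - r - A in
  let SL := p 0 0 * L + p 0 3 * r in
  let SR := p 0 2 * L + p 0 1 * r in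
  mx33 (C * p 0 0 + A * p 0 6 - p 0 4 - SL) (C * p 0 2 - SR) (- eta - A * p 0 6)
       (C * p 0 3 - SL) (C * p 0 1 + A * p 0 7 - p 0 5 - SR) (- eta - A * p 0 7)
       (p 0 6 * L - SL) (p 0 7 * r - SR)
       (- eta - (p 0 6 * L + p 0 7 * r) - rho).

Lemma frozen_midpoint p x y :
  frozen_field eta rho p x - frozen_field eta rho p y = (x - y) *m frozen_jac p (2^-1 *: (x + y)).
Proof.
apply/rowP; apply: ord3P; rewrite !frozen_fieldE /= [RHS]mxE sum_ord3 mx33E.
all: by rewrite !mxE/= ?row3E; field.
Qed.

Section Continuity.
Context (T : Type) (F : set_system T) {FF : Filter F}.

Lemma cvg_entry m n (g : T -> 'M[R]_(m, n)) (l : 'M[R]_(m, n)) i j :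
  g t @[t --> F] --> l -> g t i j @[t --> F] --> l i j.
Proof.
move=> gl; have cij := @coord_continuous R m n i j l.
exact: (@cvg_comp _ _ _ g (fun M => M i j) _ _ _ gl cij).
Qed.

Lemma cvg_mx33 (a b c d e f g h i : T -> R) a' b' c' d' e' f' g' h' i' :
  a t @[t --> F] --> a' -> b t @[t --> F] --> b' -> c t @[t --> F] --> c' ->
  d t @[t --> F] --> d' -> e t @[t --> F] --> e' -> f t @[t --> F] --> f' ->
  g t @[t --> F] --> g' -> h t @[t --> F] --> h' -> i t @[t --> F] --> i' ->
  mx33 (a t) (b t) (c t) (d t) (e t) (f t) (g t) (h t) (i t) @[t --> F]
    --> mx33 a' b' c' d' e' f' g' h' i'.
Proof.
move=> *; apply: cvg_entries; apply: ord3P; apply: ord3P.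
all: by under eq_fun do rewrite mx33E; rewrite mx33E.
Qed.

Lemma cvg_frozen_jac (q : T -> 'rV[R]_8) (x : T -> 'rV[R]_3) p (E : 'rV[R]_3) :
  q t @[t --> F] --> p -> x t @[t --> F] --> E ->
  frozen_jac (q t) (x t) @[t --> F] --> frozen_jac p E.
Proof.
move=> qp xE.
have cq k : q t 0 k @[t --> F] --> p 0 k by exact: cvg_entry.
have cx k : x t 0 k @[t --> F] --> E 0 k by exact: cvg_entry.
have cc (a : R) : (cst a : T -> R) @ F --> a by exact: cvg_cst.
have cC : 1 - x t 0 0 - x t 0 1 - x t 0 2 @[t --> F]
    --> 1 - E 0 0 - E 0 1 - E 0 2.
  exact: (cvgB (cvgB (cvgB (cc _) (cx 0)) (cx 1)) (cx 2)).
have cS i j : q t 0 i * x t 0 0 + q t 0 j * x t 0 1 @[t --> F]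
    --> p 0 i * E 0 0 + p 0 j * E 0 1.
  exact: (cvgD (cvgM (cq i) (cx 0)) (cvgM (cq j) (cx 1))).
apply: cvg_mx33.
- exact: (cvgB (cvgB (cvgD (cvgM cC (cq 0)) (cvgM (cx 2) (cq 6))) (cq 4))
    (cS 0 3)).
- exact: (cvgB (cvgM cC (cq 2)) (cS 2 1)).
- exact: (cvgB (cc _) (cvgM (cx 2) (cq 6))).
- exact: (cvgB (cvgM cC (cq 3)) (cS 0 3)).
- exact: (cvgB (cvgB (cvgD (cvgM cC (cq 1)) (cvgM (cx 2) (cq 7))) (cq 5))
    (cS 2 1)).
- exact: (cvgB (cc _) (cvgM (cx 2) (cq 7))).
- exact: (cvgB (cvgM (cq 6) (cx 0)) (cS 0 3)).
- exact: (cvgB (cvgM (cq 7) (cx 1)) (cS 2 1)).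
- exact: (cvgB (cvgB (cc _) (cS 6 7)) (cc _)).
Qed.

Lemma cvg_frozen_field (q : T -> 'rV[R]_8) x p :
  q t @[t --> F] --> p ->
  frozen_field eta rho (q t) x @[t --> F] --> frozen_field eta rho p x.
Proof.
move=> qp.
have cq k : q t 0 k @[t --> F] --> p 0 k by exact: cvg_entry.
have cc (a : R) : (cst a : T -> R) @ F --> a by exact: cvg_cst.
apply: cvg_entries => i; rewrite (ord1 i); apply: ord3P;
  under eq_fun do rewrite frozen_fieldE /= row3E; rewrite frozen_fieldE /= row3E.
- exact: (cvgD (cvgM (cvgB (cvgD (cvgM (cc _) (cq 0)) (cvgM (cc _) (cq 6)))
    (cq 4)) (cc _)) (cvgM (cvgM (cc _) (cq 3)) (cc _))).
- exact: (cvgD (cvgM (cvgM (cc _) (cq 2)) (cc _)) (cvgM (cvgB (cvgD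
    (cvgM (cc _) (cq 1)) (cvgM (cc _) (cq 7))) (cq 5)) (cc _))).
- exact: (cvgB (cvgB (cc _) (cvgM (cc _) (cvgD (cvgM (cq 6) (cc _))
    (cvgM (cq 7) (cc _))))) (cc _)).
Qed.

Lemma cvg_midpoint (x y : T -> 'rV[R]_3) (E : 'rV[R]_3) :
  x t @[t --> F] --> E -> y t @[t --> F] --> E ->
  2^-1 *: (x t + y t) @[t --> F] --> E.
Proof.
move=> xE yE.
have -> : E = 2^-1 *: (E + E) by apply/rowP => i; rewrite !mxE; field.
have c2 : (cst 2^-1 : T -> R) @ F --> (2^-1 : R) by exact: cvg_cst.
exact: (cvgZ c2 (cvgD xE yE)).
Qed.

Lemma cvg_det3 (g : T -> 'M[R]_3) (l : 'M[R]_3) :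
  g t @[t --> F] --> l -> \det (g t) @[t --> F] --> \det l.
Proof.
move=> gl; under eq_fun do rewrite det_mx33; rewrite det_mx33.
have c i j : g t i j @[t --> F] --> l i j by exact: cvg_entry.
exact: (cvgD (cvgB
  (cvgM (c 0 0) (cvgB (cvgM (c 1 1) (c 2 2)) (cvgM (c 1 2) (c 2 1))))
  (cvgM (c 0 1) (cvgB (cvgM (c 1 0) (c 2 2)) (cvgM (c 1 2) (c 2 0)))))
  (cvgM (c 0 2) (cvgB (cvgM (c 1 0) (c 2 1)) (cvgM (c 1 1) (c 2 0))))).
Qed.

Lemma cvg_mxtrace3 (g : T -> 'M[R]_3) (l : 'M[R]_3) :
  g t @[t --> F] --> l -> \tr (g t) @[t --> F] --> \tr l.
Proof.
move=> gl; under eq_fun do rewrite /mxtrace sum_ord3; rewrite /mxtrace sum_ord3.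
have c i j : g t i j @[t --> F] --> l i j by exact: cvg_entry.
exact: (cvgD (cvgD (c 0 0) (c 1 1)) (c 2 2)).
Qed.

End Continuity.

End FrozenSystem.

(** * Persistence of equilibria and of their stability types *)

Section Branches.
Variables (R : realType) (eta rho : R).
Implicit Types (p : 'rV[R]_8) (x : 'rV[R]_3).
Local Notation frozen_jac := (frozen_jac eta rho).

Section Persistence.
Variables (p0 : 'rV[R]_8) (E0 : 'rV[R]_3) (E : 'rV[R]_8 -> 'rV[R]_3).
Hypotheses (Ep0 : E p0 = E0) (cE : {for p0, continuous E}).

Lemma jacobian_frozen p x : 'J (frozen_field eta rho p) x = frozen_jac p x.
Proof.
have xx : 2^-1 *: (x + x) = x by apply/rowP => i; rewrite !mxE; field.
have <- : frozen_jac p (2^-1 *: (x + x)) = frozen_jac p x by rewrite xx.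
apply: (@jacobian_slope _ _ _ _ (fun y => frozen_jac p (2^-1 *: (y + x)))).
- by move=> y; exact: frozen_midpoint.
- apply: (@cvg_frozen_jac R eta rho _ (nbhs x) _ (cst p)
    (fun y => 2^-1 *: (y + x))).
    exact: cvg_cst.
  rewrite xx.
  apply: (@cvg_midpoint R _ (nbhs x) _ id (cst x) x); first exact: cvg_id.
  exact: cvg_cst.
Qed.

(** Asymptotic stability, certified at [p0] by a quadratic form, is inherited by
    the continuation [E] of the equilibrium [E0]. *)
Lemma near_stable (P : 'M[R]_3) (c1 c : R) :
  P^T = P -> 0 < c1 -> (forall h, c1 * `|h| ^+ 2 <= bform P h h) -> 0 < c ->
  contracting P c (frozen_jac p0 E0) ->
  (\forall p \near p0, frozen_field eta rho p (E p) = 0) ->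
  \forall p \near p0, hyperbolic (frozen_field eta rho p) (E p) /\
    locally_asymptotically_stable (frozen_field eta rho p) (E p).
Proof.
move=> PT c10 P1 c0 cJ zE.
have P_gt0 h : h != 0 -> 0 < bform P h h.
  move=> h0; apply: lt_le_trans (P1 h).
  by rewrite mulr_gt0// exprn_gt0// normr_gt0.
have c20 : 0 < c / 2 by rewrite divr_gt0.
(* the filters of neighbourhoods are given explicitly below, since unification
   would otherwise unfold them entrywise *)
have nJ : \forall z \near (p0, E0), contracting P (c / 2) (frozen_jac z.1 z.2).
  have c2c : c / 2 < c by lra.
  have := contracting_near c2c cJ.
  apply: (@cvg_frozen_jac R eta rho _ (nbhs (p0, E0)) _ fst snd p0 E0).
  - exact: cvg_fst.
  - exact: cvg_snd.
have pE : (p, E p) @[p --> p0] --> (p0, E0).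
  apply: (@cvg_pair _ _ _ (nbhs p0) (nbhs p0) (nbhs E0) _ _ _ id E).
    exact: cvg_id.
  by rewrite -Ep0; exact: cE.
have npJ := pE _ (near_join nJ).
near=> p.
have zEp : frozen_field eta rho p (E p) = 0 by near: p.
have nxJ : \forall z \near (p, E p), contracting P (c / 2) (frozen_jac z.1 z.2).
  by near: p.
have jE := jacobian_frozen p (E p).
split.
  move=> z; rewrite /complex_jacobian jE => ez.
  have := eigenvalue_contracting PT P_gt0 c20 (nbhs_singleton nxJ) ez.
  by move/lt_eqF => ->.
apply: (contracting_asymptotically_stable
  (S := fun x => frozen_jac p (2^-1 *: (x + E p))) PT c10 P1 c20) => [x|].
  by rewrite -frozen_midpoint zEp subr0.
have : (p, 2^-1 *: (x + E p)) @[x --> E p] --> (p, E p).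
  apply: (@cvg_pair _ _ _ (nbhs (E p)) (nbhs p) (nbhs (E p)) _ _ _ (cst p)).
    exact: cvg_cst.
  apply: (@cvg_midpoint R _ (nbhs (E p)) _ id (cst (E p)) (E p)).
    exact: cvg_id.
  exact: cvg_cst.
by move=> /(_ _ nxJ).
Unshelve. all: by end_near. Qed.

Lemma near_saddle :
  \tr (frozen_jac p0 E0) < 0 -> 0 < \det (frozen_jac p0 E0) ->
  \forall p \near p0, saddle_one_unstable (frozen_field eta rho p) (E p).
Proof.
move=> tr0 det0.
have cJ : frozen_jac p (E p) @[p --> p0] --> frozen_jac p0 E0.
  apply: (@cvg_frozen_jac R eta rho _ (nbhs p0) _ id E p0 E0).
    exact: cvg_id.
  by rewrite -Ep0; exact: cE.
have ntr : \forall p \near p0, \tr (frozen_jac p (E p)) < 0.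
  have ctr : \tr (frozen_jac p (E p)) @[p --> p0] --> \tr (frozen_jac p0 E0).
    exact: cvg_mxtrace3 cJ.
  by move/cvgr_lt : ctr; apply.
have ndet : \forall p \near p0, 0 < \det (frozen_jac p (E p)).
  have cdet : \det (frozen_jac p (E p)) @[p --> p0] --> \det (frozen_jac p0 E0).
    exact: cvg_det3 cJ.
  by move/cvgr_gt : cdet; apply.
near=> p.
rewrite /saddle_one_unstable /complex_jacobian jacobian_frozen.
by apply: char_poly_one_unstable; near: p.
Unshelve. all: by end_near. Qed.

Lemma near_interior_state :
  0 < E0 0 0 -> 0 < E0 0 1 -> 0 < E0 0 2 -> E0 0 0 + E0 0 1 + E0 0 2 < 1 ->
  \forall p \near p0, [/\ simplexT (E p), 0 < E p 0 0 & 0 < E p 0 1].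
Proof.
move=> L0 R0 A0 S1.
have cEk k : E p 0 k @[p --> p0] --> E0 0 k.
  apply: (@cvg_entry R _ (nbhs p0) _ _ E E0).
  by rewrite -Ep0; exact: cE.
have pos k : 0 < E0 0 k -> \forall p \near p0, 0 < E p 0 k.
  by move=> E0k; have /cvgr_gt := cEk k; apply.
have nL := pos _ L0; have nR := pos _ R0; have nA := pos _ A0.
have nS : \forall p \near p0, E p 0 0 + E p 0 1 + E p 0 2 < 1.
  have cS : E p 0 0 + E p 0 1 + E p 0 2 @[p --> p0]
      --> E0 0 0 + E0 0 1 + E0 0 2.
    exact: (cvgD (cvgD (cEk 0) (cEk 1)) (cEk 2)).
  by move/cvgr_lt : cS; apply.
near=> p.
have Lp : 0 < E p 0 0 by near: p.
have Rp : 0 < E p 0 1 by near: p.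
have Ap : 0 < E p 0 2 by near: p.
have Sp : E p 0 0 + E p 0 1 + E p 0 2 < 1 by near: p.
by split=> //; split; exact: ltW.
Unshelve. all: by end_near. Qed.

End Persistence.

(** Continuation of an equilibrium with invertible Jacobian matrix. *)
Lemma frozen_branch (p0 : 'rV[R]_8) (E0 : 'rV[R]_3) :
  frozen_field eta rho p0 E0 = 0 -> \det (frozen_jac p0 E0) != 0 ->
  exists E : 'rV[R]_8 -> 'rV[R]_3, E p0 = E0 /\
    \forall p \near p0, {for p, continuous E} /\
      frozen_field eta rho p (E p) = 0.
Proof.
move=> F0 det0; apply: (@implicit_zero R _ _ _ frozen_jac p0 E0) => //.
- exact: frozen_midpoint.
- apply: (@cvg_frozen_jac R eta rho _ (nbhs (p0, E0)) _ fst snd p0 E0).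
  + exact: cvg_fst.
  + exact: cvg_snd.
- move=> x p; apply: (@cvg_frozen_field R eta rho _ (nbhs p) _ id x p).
  exact: cvg_id.
- by rewrite unitmxE unitfE.
Qed.

End Branches.

(** * The symmetric baseline *)

Section SymmetricBaseline.
Variables (R : realType) (alpha gamma : R).
Hypotheses (alpha_gt0 : 0 < alpha) (gamma_gt0 : 0 < gamma).
Hypothesis alphaDgamma : alpha + gamma = 2.

Let p0 : 'rV[R]_8 := params alpha alpha gamma gamma 1 1 (3 / 5) (3 / 5).
Let f := @frozen_field R (1 / 5) (1 / 20).
Let J := @frozen_jac R (1 / 5) (1 / 20).
Let Edag0 : 'rV[R]_3 := row3 0 0 (4 / 5).
Let Eplus0 : 'rV[R]_3 := row3 (1 / 12) (1 / 12) (10 / 21).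
Let Eminus0 : 'rV[R]_3 := row3 (3 / 40) (3 / 40) (1 / 2).

Let alphaE : alpha = 2 - gamma. Proof. by rewrite -alphaDgamma addrK. Qed.

Lemma paramsE : ((p0 0 0 = alpha) * (p0 0 1 = alpha) * (p0 0 2 = gamma) *
  (p0 0 3 = gamma) * (p0 0 4 = 1) * (p0 0 5 = 1) * (p0 0 6 = 3 / 5) *
  (p0 0 7 = 3 / 5))%type.
Proof. by rewrite !mxE. Qed.

Lemma baseline_positive : positive_params p0.
Proof.
move=> i; rewrite mxE; have [a g] := (alpha_gt0, gamma_gt0).
by case: i; do 8?[case]; move=> //= *; lra.
Qed.

Lemma row3_eq0 (a b c : R) : a = 0 -> b = 0 -> c = 0 -> row3 a b c = 0.
Proof.
by move=> -> -> ->; apply/rowP; apply: ord3P; rewrite row3E mxE.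
Qed.

Lemma radical_free_equilibrium p : f p Edag0 = 0.
Proof. by rewrite /f frozen_fieldE /= !row3E; apply: row3_eq0; field. Qed.

Lemma positive_equilibrium : f p0 Eplus0 = 0.
Proof.
by rewrite /f frozen_fieldE /= !row3E !paramsE alphaE; apply: row3_eq0; field.
Qed.

Lemma saddle_equilibrium : f p0 Eminus0 = 0.
Proof.
by rewrite /f frozen_fieldE /= !row3E !paramsE alphaE; apply: row3_eq0; field.
Qed.

Lemma det_positive_neq0 : \det (J p0 Eplus0) != 0.
Proof.
have -> : \det (J p0 Eplus0) = - (gamma / 420).
  by rewrite det_mx33 /J !mx33E !row3E !paramsE alphaE; field.
by rewrite oppr_eq0 mulf_neq0// gt_eqF.
Qed.

Lemma det_saddle_gt0 : 0 < \det (J p0 Eminus0).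
Proof.
have -> : \det (J p0 Eminus0) = 21 / 10000 * gamma.
  by rewrite det_mx33 /J !mx33E !row3E !paramsE alphaE; field.
by have := gamma_gt0; lra.
Qed.

Lemma trace_saddle : \tr (J p0 Eminus0) < 0.
Proof.
rewrite /mxtrace sum_ord3 /J !mx33E !row3E !paramsE alphaE.
by have := gamma_gt0; lra.
Qed.

(** In the coordinates [u = L + R], [w = L - R] and [A] the linearization at
    [Edag0] is [u' = - 3/25 u], [w' = - (3/25 + 2 gamma / 5) w] and
    [A' = - 17/25 u - A / 4]; a large weight on [u] absorbs the coupling. *)
Lemma contracting_radical_free :
  contracting (mode_form 100 1 1) (1 / 10) (J p0 Edag0).
Proof.
move=> h; rewrite form_modeE; have := sqr_norm_le3 h.
rewrite !mxE !sum_ord3 /J !mx33E !row3E !paramsE alphaE.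
set a := h 0 0; set b := h 0 1; set c := h 0 2 => hn.
have g := gamma_gt0.
have w0 : 0 <= gamma * (a - b) ^+ 2 by rewrite mulr_ge0 ?sqr_ge0 ?ltW.
have := sqr_ge0 (a + b + c); have := sqr_ge0 (a + b); have := sqr_ge0 (a - b).
have := sqr_ge0 c.
nra.
Qed.

(** In the same coordinates the linearization at [Eplus0] is
    [u' = - u / 3 - 7/30 A], [A' = - 17/35 u - 7/20 A] and
    [w' = - 5/7 gamma w]; the weights [102] and [49] make the two coupling
    terms equal. *)
Lemma contracting_positive :
  contracting (mode_form 102 1 49) (gamma / 10) (J p0 Eplus0).
Proof.
move=> h; rewrite form_modeE; have := sqr_norm_le3 h.
rewrite !mxE !sum_ord3 /J !mx33E !row3E !paramsE alphaE.
set a := h 0 0; set b := h 0 1; set c := h 0 2 => hn.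
have g := gamma_gt0; have ag := alpha_gt0.
have g2 : gamma < 2 by move: ag; rewrite alphaE; lra.
apply: (@le_trans _ _ (- (gamma / 10) * (a ^+ 2 + b ^+ 2 + c ^+ 2))); last first.
  by rewrite !mulNr lerN2 ler_wpM2l// divr_ge0// ltW.
rewrite -subr_ge0 [leRHS](_ : _ = (34 - gamma / 20) * (a + b) ^+ 2
  + 238 / 5 * (a + b) * c + (343 / 20 - gamma / 10) * c ^+ 2
  + 93 / 140 * gamma * (a - b) ^+ 2); last by field.
have w0 : 0 <= gamma * (a - b) ^+ 2 by rewrite mulr_ge0 ?sqr_ge0 ?ltW.
have u0 : 0 <= (2 - gamma) * (a + b) ^+ 2.
  by rewrite mulr_ge0 ?sqr_ge0 ?subr_ge0 ?ltW.
have c0 : 0 <= (2 - gamma) * c ^+ 2.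
  by rewrite mulr_ge0 ?sqr_ge0 ?subr_ge0 ?ltW.
(* as [gamma < 2], it suffices that [339/10 u^2 + 238/5 u c + 339/20 c^2] be
   nonnegative, with [u = a + b] *)
have := sqr_ge0 (7 / 10 * (a + b) + 1 / 2 * c); have := sqr_ge0 c.
have := sqr_ge0 (a + b).
nra.
Qed.

End SymmetricBaseline.

Theorem mainTheorem4 (R : realType) (alpha gamma : R)
    (alpha_gt0 : 0 < alpha) (gamma_gt0 : 0 < gamma)
    (alphaDgamma : alpha + gamma = 2) :
  let mu : R := 1 in
  let delta : R := 3 / 5 in
  let eta : R := 1 / 5 in
  let rho : R := 1 / 20 in
  let f := frozen_field eta rho in
  let p0 := params alpha alpha gamma gamma mu mu delta delta in
  let Edag0 := row3 0 0 (4 / 5) in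
  let Eplus0 := row3 (1 / 12) (1 / 12) (10 / 21) in
  let Eminus0 := row3 (3 / 40) (3 / 40) (1 / 2) in
  [/\ hyperbolic_equilibrium (f p0) Edag0,
      hyperbolic_equilibrium (f p0) Eplus0
    & hyperbolic_equilibrium (f p0) Eminus0] /\
  exists (U : set 'rV[R]_8) (Edag Eplus Eminus : 'rV[R]_8 -> 'rV[R]_3),
    [/\ [/\ open U, U p0 & U `<=` @positive_params R],
        [/\ {within U, continuous Edag}, {within U, continuous Eplus}
          & {within U, continuous Eminus}],
        [/\ Edag p0 = Edag0, Eplus p0 = Eplus0 & Eminus p0 = Eminus0]
      & forall p : 'rV[R]_8, U p ->
          [/\ [/\ hyperbolic_equilibrium (f p) (Edag p),
                  (Edag p) 0 0 = 0, (Edag p) 0 1 = 0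
                & locally_asymptotically_stable (f p) (Edag p)],
              [/\ hyperbolic_equilibrium (f p) (Eplus p),
                  0 < (Eplus p) 0 0, 0 < (Eplus p) 0 1
                & locally_asymptotically_stable (f p) (Eplus p)]
            & [/\ hyperbolic_equilibrium (f p) (Eminus p),
                  0 < (Eminus p) 0 0, 0 < (Eminus p) 0 1
                & saddle_one_unstable (f p) (Eminus p)]]].
Proof.
move=> mu delta eta rho f p0 Edag0 Eplus0 Eminus0.
have [Eplus [Eplus0E nplus]] : exists E : 'rV[R]_8 -> 'rV[R]_3,
    E p0 = Eplus0 /\
    \forall p \near p0, {for p, continuous E} /\ f p (E p) = 0.
  apply: frozen_branch; first exact: positive_equilibrium.
  exact: det_positive_neq0.
have [Eminus [Eminus0E nminus]] : exists E : 'rV[R]_8 -> 'rV[R]_3,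
    E p0 = Eminus0 /\
    \forall p \near p0, {for p, continuous E} /\ f p (E p) = 0.
  apply: frozen_branch; first exact: saddle_equilibrium.
  by rewrite gt_eqF//; exact: det_saddle_gt0.
have cplus : {for p0, continuous Eplus} by have [] := nbhs_singleton nplus.
have cminus : {for p0, continuous Eminus} by have [] := nbhs_singleton nminus.
have npos : \forall p \near p0, positive_params p.
  have posi (i : 'I_8) : \forall p \near p0, 0 < (p : 'rV[R]_8) 0 i.
    have ci : (p : 'rV[R]_8) 0 i @[p --> p0] --> p0 0 i.
      exact: (@cvg_entry R _ (nbhs p0) _ _ id p0 0 i cvg_id).
    by move/cvgr_gt : ci; apply; exact: baseline_positive.
  exact: (filter_forall (nbhs_filter p0) posi).
have cdag : {for p0, continuous (cst Edag0 : 'rV[R]_8 -> 'rV[R]_3)}.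
  exact: cst_continuous.
have sdag : \forall p \near p0, hyperbolic (f p) Edag0 /\
    locally_asymptotically_stable (f p) Edag0.
  apply: (@near_stable R eta rho p0 Edag0 (cst Edag0) erefl cdag
    (mode_form 100 1 1) 1 (1 / 10)) => //.
  - exact: mode_form_sym.
  - by move=> h; apply: mode_form_ge; rewrite ?ler1n.
  - exact: contracting_radical_free.
  - by near=> p; exact: radical_free_equilibrium.
have splus : \forall p \near p0, hyperbolic (f p) (Eplus p) /\
    locally_asymptotically_stable (f p) (Eplus p).
  apply: (@near_stable R eta rho p0 Eplus0 Eplus Eplus0E cplus
    (mode_form 102 1 49) 1 (gamma / 10)) => //.
  - exact: mode_form_sym.
  - by move=> h; apply: mode_form_ge; rewrite ?ler1n.
  - by rewrite divr_gt0.
  - exact: contracting_positive.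
  - by apply: filterS nplus => p [].
have sminus : \forall p \near p0, saddle_one_unstable (f p) (Eminus p).
  apply: (@near_saddle R eta rho p0 Eminus0 Eminus Eminus0E cminus).
    exact: trace_saddle.
  exact: det_saddle_gt0.
have iplus : \forall p \near p0,
    [/\ simplexT (Eplus p), 0 < Eplus p 0 0 & 0 < Eplus p 0 1].
  by apply: (near_interior_state Eplus0E cplus); rewrite !row3E; lra.
have iminus : \forall p \near p0,
    [/\ simplexT (Eminus p), 0 < Eminus p 0 0 & 0 < Eminus p 0 1].
  by apply: (near_interior_state Eminus0E cminus); rewrite !row3E; lra.
pose good p := [/\ positive_params p,
  {for p, continuous Eplus} /\ f p (Eplus p) = 0,
  {for p, continuous Eminus} /\ f p (Eminus p) = 0,
  hyperbolic (f p) Edag0 /\ locally_asymptotically_stable (f p) Edag0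
  & [/\ hyperbolic (f p) (Eplus p) /\
        locally_asymptotically_stable (f p) (Eplus p),
      saddle_one_unstable (f p) (Eminus p),
      [/\ simplexT (Eplus p), 0 < Eplus p 0 0 & 0 < Eplus p 0 1]
    & [/\ simplexT (Eminus p), 0 < Eminus p 0 0 & 0 < Eminus p 0 1]]].
have ngood : \forall p \near p0, good p.
  by near=> p; split; [..|split]; near: p.
pose U := interior good.
have Ugood p : U p -> good p by exact: nbhs_singleton.
have Up0 : U p0 by [].
have types p : U p ->
  [/\ [/\ hyperbolic_equilibrium (f p) Edag0,
          Edag0 0 0 = 0, Edag0 0 1 = 0
        & locally_asymptotically_stable (f p) Edag0],
      [/\ hyperbolic_equilibrium (f p) (Eplus p),
          0 < Eplus p 0 0, 0 < Eplus p 0 1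
        & locally_asymptotically_stable (f p) (Eplus p)]
    & [/\ hyperbolic_equilibrium (f p) (Eminus p),
          0 < Eminus p 0 0, 0 < Eminus p 0 1
        & saddle_one_unstable (f p) (Eminus p)]].
  move=> /Ugood[_ [_ zplus] [_ zminus] [hdag ldag]
    [[hplus lplus] sdl [Tplus Lplus Rplus] [Tminus Lminus Rminus]]].
  split.
  - split; [|by rewrite row3E|by rewrite row3E|exact: ldag].
    split; [split|exact: hdag]; last exact: radical_free_equilibrium.
    by split; rewrite !row3E; lra.
  - split; [|exact: Lplus|exact: Rplus|exact: lplus].
    by split; [split; [exact: Tplus|exact: zplus]|exact: hplus].
  - split; [|exact: Lminus|exact: Rminus|exact: sdl].
    by split; [split; [exact: Tminus|exact: zminus]|exact: saddle_hyperbolic sdl].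
have [[hdag _ _ _] [hplus _ _ _] [hminus _ _ _]] := types _ Up0.
split; first by rewrite -Eplus0E -Eminus0E.
exists U, (cst Edag0), Eplus, Eminus; split => //.
- split=> //; first exact: open_interior.
  by move=> p /Ugood[].
- split.
  + by apply: continuous_subspaceT; exact: cst_continuous.
  + by apply: continuous_in_subspaceT => p /set_mem/Ugood[_ []].
  + by apply: continuous_in_subspaceT => p /set_mem/Ugood[_ _ []].
Unshelve. all: by end_near. Qed.
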